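(* Let $\sigma,a,b,\lambda$ be functions of $t$ on a bootstrap interval with $\lambda>0$, $b>0$, $\lambda'(t)=-\sigma(t)\lambda(t)$, and define $A(t)=\lambda(t)a(t)$, $B(t)=\lambda(t)^{1/2}b(t)$. Assume on the interval that, for constants $c_0,c_1>0$, $$\sigma(t)\ge c_0A(t),\qquad a'(t)\ge\sigma(t)a(t)+c_1b(t)^2,\qquad b'(t)=\sigma(t)b(t).$$ Then $$A'(t)\ge c_1B(t)^2,\qquad B'(t)\ge\frac{c_0}{2}A(t)B(t).$$ If $A(0)>0$ and $B(0)>0$, the comparison system $$\underline A'=c_1\underline B^2,\qquad\underline B'=\frac{c_0}{2}\underline A\,\underline B,\qquad \underline A(0)=A(0),\ \underline B(0)=B(0),$$ blows up in finite time.
   Context: In the paper, $\sigma(t)=-\partial_zu^z(1,0,t)$, $a(t)=\partial_zG(1,0,t)$, $b(t)=\partial_z\Gamma(1,0,t)$ for a smooth axisymmetric Euler solution with swirl, with $\Gamma=ru^\theta$ and $G=\omega^\theta/r$; only the differentiability of $\sigma$-driven quantities $a,b,\lambda$ (continuously differentiable, $\sigma$ continuous) and the stated relations are used. *)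

(* Defs.v *)
From Stdlib Require Import Reals.
From Coquelicot Require Import Coquelicot.
Open Scope R_scope.

(* A nondegenerate interval with left endpoint 0 (included): [0, T), [0, T] or
   [0, +oo).  Nondegeneracy makes derivatives relative to [J] unique. *)
Definition time_interval (J : R -> Prop) : Prop :=
  J 0 /\
  (forall t, J t -> 0 <= t) /\
  (forall s t u, J s -> J u -> s <= t <= u -> J t) /\
  (exists t, J t /\ 0 < t).

(* Coquelicot's [is_derive] with [locally t] replaced by its trace on [J]; hence
   two-sided in the interior of [J] and one-sided at endpoints belonging to [J]. *)
Definition is_derive_within (J : R -> Prop) (f : R -> R) (t l : R) : Prop :=
  filterdiff f (within J (locally t)) (fun h : R => scal h l).

Definition is_C1_on (J : R -> Prop) (f f' : R -> R) : Prop :=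
  (forall t, J t -> is_derive_within J f t (f' t)) /\ continuous_on J f'.

(* (X, Y) solves X' = c1 Y^2, Y' = (c0/2) X Y on [0, S) with data (X0, Y0). *)
Definition comparison_solution (c0 c1 X0 Y0 S : R) (X Y : R -> R) : Prop :=
  let I := fun t => 0 <= t < S in
  X 0 = X0 /\ Y 0 = Y0 /\
  (forall t, I t -> is_derive_within I X t (c1 * Y t ^ 2)) /\
  (forall t, I t -> is_derive_within I Y t (c0 / 2 * X t * Y t)).

(* The initial value problem has a unique maximal solution; its lifespan T is
   finite and its norm tends to infinity at T. *)
Definition comparison_blows_up (c0 c1 X0 Y0 : R) : Prop :=
  exists (T : R) (X Y : R -> R),
    0 < T /\
    comparison_solution c0 c1 X0 Y0 T X Y /\
    filterlim (fun t => norm (X t, Y t)) (at_left T) (Rbar_locally p_infty) /\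
    (forall (S : R) (X1 Y1 : R -> R),
       0 < S -> comparison_solution c0 c1 X0 Y0 S X1 Y1 ->
       S <= T /\ (forall t, 0 <= t < S -> X1 t = X t /\ Y1 t = Y t)).

(* Main.v *)
Require Import Defs.
From Stdlib Require Import Reals Lra.
From Coquelicot Require Import Coquelicot.
Open Scope R_scope.

(** The two differential inequalities are the product rule: differentiating
    [lam * a] and [sqrt lam * b] with [lam' = - sigma * lam] cancels one
    multiple of [sigma], and the lower bounds on [a'] and [sigma] do the rest.

    For the comparison system put [k = c0 / 2].  The substitution [w = Y0 / Y]
    linearises it: [w' = - k X w], and since [k X^2 - c1 Y^2] is conserved,
    [w'' = q w] with the constant [q = k (k X0^2 - c1 Y0^2)].  So [w] is the
    solution of a linear equation with data [w 0 = 1], [w' 0 = - k X0] and exists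
    for all times.  As [0 < k X0] and [q < (k X0)^2], it has a zero at a positive
    time ([linear_ode_reaches_zero]); let [T] be the first one
    ([first_zero]).  On [[0, T)] the formulas [Y = Y0 / w], [X = - w' / (k w)]
    solve the system, and [Y] tends to infinity at [T].

    For uniqueness take any solution [(X1, Y1)] on [[0, S)].  The defect
    [Z = w' + k w X1] satisfies [Z' = k X1 Z] and [Z 0 = 0], so it vanishes
    ([linear_ode_zero]; the coefficient is bounded above because [X1] is
    nondecreasing).  Then [(w Y1)' = Z Y1 = 0], hence [w Y1 = Y0] on all of
    [[0, S)].  This excludes a zero of [w] there, so [S <= T], and it determines
    [Y1], while [Z = 0] determines [X1]. *)

(** * Derivatives relative to a set *)

Lemma within_locally_proper (J : R -> Prop) (t : R) :
  J t -> ProperFilter (within J (locally t)).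
Proof.
intros Ht; constructor.
- intros P [d Hd]; exists t; apply (Hd t); [apply ball_center | exact Ht].
- apply within_filter, locally_filter.
Qed.

Lemma within_locally_lim (J : R -> Prop) (t : R) :
  is_filter_lim (within J (locally t)) t.
Proof. intros P HP; apply (filter_le_within J P HP). Qed.

Lemma is_derive_within_continuous (J : R -> Prop) (f : R -> R) (t l : R) :
  is_derive_within J f t l ->
  filterlim f (within J (locally t)) (locally (f t)).
Proof.
intros Hf.
apply (filterdiff_continuous_aux (K := R_AbsRing) (U := R_NormedModule)
         (V := R_NormedModule) f).
- exists (fun h : R => scal h l); exact Hf.
- apply within_locally_lim.
Qed.

Lemma is_derive_is_derive_within (J : R -> Prop) (f : R -> R) (t l : R) :
  J t -> is_derive f t l -> is_derive_within J f t l.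
Proof.
intros Ht Hf.
pose proof (within_locally_proper J t Ht).
apply (filterdiff_locally f t _ (within_locally_lim J t) Hf).
Qed.

Lemma is_derive_within_interior (J : R -> Prop) (f : R -> R) (t l : R) :
  locally t J -> is_derive_within J f t l -> is_derive f t l.
Proof.
intros HJ [Hlin Hf]; split; [exact Hlin |].
intros x Hx.
assert (Hle : filter_le (locally t) (within J (locally t))).
{ intros P HP; unfold within in HP.
  generalize (filter_and _ _ HJ HP); apply filter_imp; intros y [H1 H2]; auto. }
apply (is_domin_le _ _ (Hf x (fun P HP => filter_le_within J P (Hx P HP))) Hle).
Qed.

Lemma is_derive_within_eq (J : R -> Prop) (f : R -> R) (t l l' : R) :
  is_derive_within J f t l -> l = l' -> is_derive_within J f t l'.
Proof. now intros H <-. Qed.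

Lemma is_derive_within_plus (J : R -> Prop) (f g : R -> R) (t l m : R) :
  is_derive_within J f t l -> is_derive_within J g t m ->
  is_derive_within J (fun x => f x + g x) t (l + m).
Proof.
intros Hf Hg.
refine (filterdiff_ext_lin _ _ _ (filterdiff_plus_fct _ _ _ _ Hf Hg) _).
intros y; unfold plus, scal; simpl; unfold mult; simpl; ring.
Qed.

Lemma is_derive_within_mult (J : R -> Prop) (f g : R -> R) (t l m : R) :
  J t -> is_derive_within J f t l -> is_derive_within J g t m ->
  is_derive_within J (fun x => f x * g x) t (l * g t + f t * m).
Proof.
intros Ht Hf Hg.
pose proof (within_locally_proper J t Ht) as HP.
assert (Hlim : is_filter_lim
  (filtermap (fun x => (f x, g x)) (within J (locally t))) (f t, g t)).
{ intros P [d Hd].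
  pose proof (is_derive_within_continuous _ _ _ _ Hf) as Cf.
  pose proof (is_derive_within_continuous _ _ _ _ Hg) as Cg.
  change (within J (locally t) (fun x => P (f x, g x))).
  apply (filter_imp (fun x => ball (f t) d (f x) /\ ball (g t) d (g x))).
  - intros x [H1 H2]; apply Hd; split; assumption.
  - apply filter_and; [apply (Cf _ (locally_ball (f t) d))
                      | apply (Cg _ (locally_ball (g t) d))]. }
refine (filterdiff_ext_lin _ _ _
  (filterdiff_comp_2 f g mult _ _ (fun u v => plus (mult u (g t)) (mult (f t) v))
     Hf Hg _) _).
- pose proof (filtermap_proper_filter _ _ (fun x => (f x, g x)) _ HP).
  exact (filterdiff_mult (K := R_AbsRing) (f t, g t) Hlim Rmult_comm).
- intros y; unfold plus, scal; simpl; unfold mult; simpl; ring.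
Qed.

Lemma is_derive_within_comp (J : R -> Prop) (f g : R -> R) (t l m : R) :
  J t -> is_derive_within J f t l -> is_derive g (f t) m ->
  is_derive_within J (fun x => g (f x)) t (l * m).
Proof.
intros Ht Hf Hg.
pose proof (within_locally_proper J t Ht) as HP.
refine (filterdiff_ext_lin _ _ _ (filterdiff_comp f g _ _ Hf _) _).
- pose proof (filtermap_proper_filter _ _ f _ HP).
  refine (filterdiff_locally g (f t) _ _ Hg).
  exact (is_derive_within_continuous _ _ _ _ Hf).
- intros y; unfold scal; simpl; unfold mult; simpl; ring.
Qed.

Lemma is_derive_within_scal (J : R -> Prop) (f : R -> R) (c t l : R) :
  J t -> is_derive_within J f t l ->
  is_derive_within J (fun x => c * f x) t (c * l).
Proof.
intros Ht Hf.
refine (is_derive_within_eq _ _ _ _ _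
  (is_derive_within_comp J f (fun y => c * y) t l c Ht Hf _) (Rmult_comm _ _)).
auto_derive; [exact I | ring].
Qed.

(** * Monotonicity and linear equations on [[0, S)] *)

(** At [0] only the one-sided derivative is given, while the mean value theorem
    asks for two-sided continuity; it is applied to [x |-> f (Rmax 0 x)], which
    agrees with [f] on [[0, S)] and is continuous at [0]. *)
Lemma nonneg_derive_within_le (S : R) (f f' : R -> R) (r s : R) :
  (forall t, 0 <= t < S -> is_derive_within (fun t => 0 <= t < S) f t (f' t)) ->
  0 <= r -> r <= s -> s < S ->
  (forall t, 0 <= t <= s -> 0 <= f' t) ->
  f r <= f s.
Proof.
intros Hf Hr Hrs Hs Hpos.
set (g := fun x => f (Rmax 0 x)).
assert (Hg : exists c, Rmin r s <= c <= Rmax r s /\ g s - g r = f' c * (s - r)).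
{ apply (MVT_gen g r s f').
  - rewrite Rmin_left, Rmax_right by lra; intros x Hx.
    assert (Hx0 : 0 < x) by lra.
    apply (is_derive_ext_loc f).
    + exists (mkposreal x Hx0); intros y Hy.
      apply Rabs_lt_between' in Hy; simpl in Hy.
      unfold g; rewrite Rmax_right by lra; reflexivity.
    + apply (is_derive_within_interior (fun t => 0 <= t < S)); [| apply Hf; lra].
      assert (Hd : 0 < Rmin x (S - x)) by (apply Rmin_glb_lt; lra).
      exists (mkposreal _ Hd); intros y Hy.
      apply Rabs_lt_between' in Hy; simpl in Hy.
      pose proof (Rmin_l x (S - x)); pose proof (Rmin_r x (S - x)); lra.
  - rewrite Rmin_left, Rmax_right by lra; intros x Hx.
    apply continuity_pt_filterlim; unfold g.
    rewrite (Rmax_right 0 x) by lra.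
    refine (filterlim_comp _ _ _ (Rmax 0) f _ (within (fun t => 0 <= t < S) (locally x)) _ _ _).
    + intros P [d Hd].
      assert (He : 0 < Rmin d (S - x)) by (apply Rmin_glb_lt; [apply cond_pos | lra]).
      exists (mkposreal _ He); intros y Hy.
      apply Rabs_lt_between' in Hy; simpl in Hy.
      pose proof (Rmin_l d (S - x)); pose proof (Rmin_r d (S - x)).
      apply Hd.
      * apply Rabs_lt_between'; unfold Rmax; destruct (Rle_dec 0 y); lra.
      * unfold Rmax; destruct (Rle_dec 0 y); lra.
    + apply (is_derive_within_continuous _ _ _ (f' x)), Hf; lra. }
destruct Hg as [c [Hc Heq]].
rewrite Rmin_left, Rmax_right in Hc by lra.
unfold g in Heq; rewrite !Rmax_right in Heq by lra.
assert (0 <= f' c * (s - r)) by (apply Rmult_le_pos; [apply Hpos |]; lra).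
lra.
Qed.

Lemma zero_derive_within_const (S : R) (f f' : R -> R) (s : R) :
  (forall t, 0 <= t < S -> is_derive_within (fun t => 0 <= t < S) f t (f' t)) ->
  (forall t, 0 <= t < S -> f' t = 0) ->
  0 <= s < S -> f s = f 0.
Proof.
intros Hf H0 Hs.
apply Rle_antisym.
- assert (-1 * f 0 <= -1 * f s); [| lra].
  apply (nonneg_derive_within_le S (fun t => -1 * f t) (fun t => -1 * f' t)); try lra.
  + intros t Ht; apply is_derive_within_scal; auto.
  + intros t Ht; rewrite H0; lra.
- apply (nonneg_derive_within_le S f f'); try lra; auto.
  intros t Ht; rewrite H0; lra.
Qed.

(** Gronwall's argument: [f^2 exp (- 2 M t)] is nonincreasing and starts at 0. *)
Lemma linear_ode_zero (S : R) (f g : R -> R) (s M : R) :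
  (forall t, 0 <= t < S ->
     is_derive_within (fun t => 0 <= t < S) f t (g t * f t)) ->
  f 0 = 0 -> 0 <= s < S ->
  (forall t, 0 <= t <= s -> g t <= M) ->
  f s = 0.
Proof.
intros Hf H0 Hs HM.
set (e := fun t => - exp (- (2 * M) * t)).
assert (Hle : e 0 * (f 0 * f 0) <= e s * (f s * f s)).
{ apply (nonneg_derive_within_le S (fun t => e t * (f t * f t))
    (fun t => 2 * M * exp (- (2 * M) * t) * (f t * f t)
              + e t * (g t * f t * f t + f t * (g t * f t)))); try lra.
  - intros t Ht.
    apply (is_derive_within_mult _ e (fun t => f t * f t)); [exact Ht | |].
    + apply is_derive_is_derive_within; [exact Ht |].
      unfold e; auto_derive; [exact I | ring].
    + apply is_derive_within_mult; auto.
  - intros t Ht; unfold e.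
    replace (_ + _) with (2 * ((M - g t) * exp (- (2 * M) * t) * (f t * f t))) by ring.
    pose proof (HM t Ht); pose proof (exp_pos (- (2 * M) * t)).
    pose proof (Rle_0_sqr (f t)); unfold Rsqr in *.
    apply Rmult_le_pos; [lra | apply Rmult_le_pos; [apply Rmult_le_pos |]; lra]. }
rewrite H0 in Hle; unfold e in Hle.
pose proof (exp_pos (- (2 * M) * s)).
pose proof (Rle_0_sqr (f s)); unfold Rsqr in *.
apply Rsqr_0_uniq; unfold Rsqr; nra.
Qed.

(** * The linearised equation *)

(** If [q <= 0] the solution is trigonometric or affine.  If [q = m^2 > 0] it is
    a combination of [exp (m t)] and [exp (- m t)] whose leading coefficient is
    negative because [m < p]. *)
Lemma linear_ode_reaches_zero (p q : R) :
  0 < p -> q < p ^ 2 ->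
  exists w w' : R -> R,
    (forall t, is_derive w t (w' t)) /\
    (forall t, is_derive w' t (q * w t)) /\
    w 0 = 1 /\ w' 0 = - p /\ exists t1, 0 < t1 /\ w t1 <= 0.
Proof.
intros Hp Hq.
destruct (Rtotal_order q 0) as [Hneg | [-> | Hpos]].
- set (m := sqrt (- q)).
  assert (Hm : 0 < m) by (apply sqrt_lt_R0; lra).
  assert (Hmm : q = - (m * m)) by (unfold m; rewrite sqrt_sqrt; lra).
  exists (fun t => cos (m * t) - p / m * sin (m * t)),
         (fun t => - m * sin (m * t) - p * cos (m * t)).
  split; [| split; [| split; [| split]]].
  + intros t; auto_derive; [exact I | field; lra].
  + intros t; auto_derive; [exact I | rewrite Hmm; field; lra].
  + rewrite Rmult_0_r, cos_0, sin_0; ring.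
  + rewrite Rmult_0_r, cos_0, sin_0; ring.
  + exists (PI / 2 / m); pose proof PI_RGT_0; split.
    * apply Rdiv_lt_0_compat; lra.
    * replace (m * (PI / 2 / m)) with (PI / 2) by (field; lra).
      rewrite cos_PI2, sin_PI2.
      pose proof (Rdiv_lt_0_compat p m Hp Hm); lra.
- exists (fun t => 1 - p * t), (fun _ => - p).
  split; [| split; [| split; [| split]]].
  + intros t; auto_derive; [exact I | ring].
  + intros t; auto_derive; [exact I | ring].
  + ring.
  + reflexivity.
  + exists (/ p); split; [now apply Rinv_0_lt_compat | rewrite Rinv_r; lra].
- set (m := sqrt q).
  assert (Hm : 0 < m) by (apply sqrt_lt_R0; lra).
  assert (Hmm : q = m * m) by (unfold m; rewrite sqrt_sqrt; lra).
  assert (Hmp : m < p) by nra.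
  exists (fun t => ((1 - p / m) * exp (m * t) + (1 + p / m) * exp (- m * t)) / 2),
         (fun t => ((m - p) * exp (m * t) - (m + p) * exp (- m * t)) / 2).
  split; [| split; [| split; [| split]]].
  + intros t; auto_derive; [exact I | field; lra].
  + intros t; auto_derive; [exact I | rewrite Hmm; field; lra].
  + rewrite !Rmult_0_r, exp_0; field; lra.
  + rewrite !Rmult_0_r, exp_0; field.
  + (* Nonpositivity means exp (2 m t) >= (p + m) / (p - m); the bound
       exp (2 m t) >= 1 + 2 m t gives this at t = 1 / (p - m). *)
    set (t := / (p - m)).
    assert (Ht : 0 < t) by (apply Rinv_0_lt_compat; lra).
    assert (Htp : t * (p - m) = 1) by (unfold t; field; lra).
    exists t; split; [exact Ht |].
    pose proof (exp_pos (- m * t)) as He.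
    assert (Hmt : 0 < m * t) by nra.
    assert (H1 : 1 + 2 * m * t < exp (2 * m * t)) by (apply exp_ineq1; lra).
    replace (exp (m * t)) with (exp (2 * m * t) * exp (- m * t))
      by (rewrite <- exp_plus; f_equal; ring).
    replace (_ / 2) with
      (- (((p - m) * exp (2 * m * t) - (p + m)) * exp (- m * t) / (2 * m)))
      by (field; lra).
    assert (0 <= ((p - m) * exp (2 * m * t) - (p + m)) * exp (- m * t) / (2 * m)).
    { apply Rdiv_le_0_compat; [| lra].
      apply Rmult_le_pos; [| lra].
      assert (0 <= (p - m) * (exp (2 * m * t) - (1 + 2 * m * t)))
        by (apply Rmult_le_pos; lra).
      nra. }
    lra.
Qed.

(** The first zero is the supremum of the times up to which [w] stays positive. *)
Lemma first_zero (w : R -> R) (t1 : R) :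
  (forall t, continuous w t) -> 0 < w 0 -> 0 < t1 -> w t1 <= 0 ->
  exists T, 0 < T /\ w T = 0 /\ forall t, 0 <= t < T -> 0 < w t.
Proof.
intros Hc H0 Ht1 Hw1.
set (E := fun x => 0 <= x /\ forall s, 0 <= s <= x -> 0 < w s).
assert (HE0 : E 0).
{ split; [lra |]; intros s Hs; replace s with 0 by lra; exact H0. }
destruct (completeness E) as [T [Hub Hlub]].
- exists t1; intros x [Hx Hpos].
  apply Rnot_lt_le; intros Hlt; specialize (Hpos t1); lra.
- exists 0; exact HE0.
- pose proof (Hub 0 HE0) as HT0.
  assert (Hlt : forall t, 0 <= t < T -> 0 < w t).
  { intros t Ht; apply Rnot_le_lt; intros Hwt.
    assert (T <= t); [| lra].
    apply Hlub; intros x [Hx Hpos].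
    apply Rnot_lt_le; intros Hlt; specialize (Hpos t); lra. }
  assert (HTle : ~ 0 < w T).
  { intros HwT.
    destruct (Hc T (fun y => 0 < y) (open_gt 0 (w T) HwT)) as [d Hd].
    pose proof (cond_pos d).
    assert (E (T + d / 2)); [| specialize (Hub _ H1); lra].
    split; [lra |]; intros s Hs.
    destruct (Rlt_dec s T); [apply Hlt; lra |].
    apply Hd, Rabs_lt_between'; lra. }
  assert (HT : 0 < T).
  { destruct HT0 as [|HT0]; [assumption |]; rewrite <- HT0 in HTle; lra. }
  exists T; repeat split; [exact HT | | exact Hlt].
  destruct (Rtotal_order (w T) 0) as [HwT | [HwT | HwT]]; [| exact HwT | lra].
  destruct (Hc T (fun y => y < 0) (open_lt 0 (w T) HwT)) as [d Hd].
  pose proof (cond_pos d).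
  set (s := Rmax 0 (T - d / 2)).
  assert (Hs : 0 <= s < T /\ T - d < s)
    by (unfold s, Rmax; destruct (Rle_dec 0 (T - d / 2)); lra).
  assert (w s < 0) by (apply Hd, Rabs_lt_between'; lra).
  specialize (Hlt s); lra.
Qed.

(** * The comparison system *)

Section Comparison.

Variables (c0 c1 X0 Y0 : R) (w w' : R -> R).
Hypotheses (hc0 : 0 < c0) (hc1 : 0 < c1) (hY0 : 0 < Y0).
Let k := c0 / 2.
Let q := k * (k * X0 ^ 2 - c1 * Y0 ^ 2).
Hypotheses (hw : forall t, is_derive w t (w' t))
           (hw' : forall t, is_derive w' t (q * w t))
           (w_0 : w 0 = 1) (w'_0 : w' 0 = - (k * X0)).

Let k_pos : 0 < k.
Proof. unfold k; lra. Qed.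

(** With [X = - w' / (k w)] and [Y = Y0 / w], this is [k w^2] times the
    conservation law [k X^2 - c1 Y^2 = k X0^2 - c1 Y0^2]. *)
Lemma linear_energy (t : R) : 0 <= t -> w' t ^ 2 - q * w t ^ 2 = k * c1 * Y0 ^ 2.
Proof.
intros Ht.
assert (H : w' t * w' t + - q * (w t * w t) = w' 0 * w' 0 + - q * (w 0 * w 0)).
{ apply (zero_derive_within_const (t + 1)
    (fun t => w' t * w' t + - q * (w t * w t))
    (fun t => (q * w t * w' t + w' t * (q * w t)) + - q * (w' t * w t + w t * w' t)));
  [| intros; ring | lra].
  intros s Hs.
  apply is_derive_within_plus; [| apply is_derive_within_scal; [exact Hs |]];
    apply is_derive_within_mult; try exact Hs;
    apply is_derive_is_derive_within; auto. }
rewrite w_0, w'_0 in H; simpl; unfold q in *; nra.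
Qed.

Lemma explicit_comparison_solution (T : R) :
  0 < T -> (forall t, 0 <= t < T -> 0 < w t) ->
  comparison_solution c0 c1 X0 Y0 T
    (fun t => - w' t / (k * w t)) (fun t => Y0 / w t).
Proof.
intros HT Hpos; split; [| split; [| split]].
- rewrite w_0, w'_0; field; lra.
- rewrite w_0; field.
- intros t Ht; pose proof (Hpos t Ht).
  apply is_derive_is_derive_within; [exact Ht |].
  auto_derive.
  + repeat split; try (eexists; apply hw || apply hw').
    apply Rmult_integral_contrapositive; lra.
  + rewrite (is_derive_unique (fun x : R => w x) _ _ (hw t)).
    rewrite (is_derive_unique (fun x : R => w' x) _ _ (hw' t)).
    apply (Rmult_eq_reg_r (k * w t ^ 2)).
    * transitivity (w' t ^ 2 - q * w t ^ 2); [field; lra |].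
      rewrite linear_energy by lra; field; lra.
    * apply Rgt_not_eq, Rmult_lt_0_compat; [lra | now apply pow_lt].
- intros t Ht; pose proof (Hpos t Ht).
  apply is_derive_is_derive_within; [exact Ht |].
  auto_derive.
  + split; [eexists; apply hw | lra].
  + rewrite (is_derive_unique (fun x : R => w x) _ _ (hw t)); fold k; field; lra.
Qed.

(** The identities are obtained without dividing by [w] or [Y1], so they hold for
    the whole lifetime of [(X1, Y1)]; this is what bounds that lifetime by the
    first zero of [w]. *)
Lemma comparison_solution_linearised (S : R) (X1 Y1 : R -> R) :
  comparison_solution c0 c1 X0 Y0 S X1 Y1 ->
  forall s, 0 <= s < S -> w' s + k * (w s * X1 s) = 0 /\ w s * Y1 s = Y0.
Proof.
intros (HX0 & HY0 & HX & HY).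
fold k in HY.
assert (HE : forall t, 0 <= t < S -> k * (k * X1 t ^ 2 - c1 * Y1 t ^ 2) = q).
{ intros t Ht; unfold q; f_equal.
  transitivity (k * (X1 t * X1 t) + - c1 * (Y1 t * Y1 t)); [ring |].
  rewrite (zero_derive_within_const S
    (fun t => k * (X1 t * X1 t) + - c1 * (Y1 t * Y1 t))
    (fun t => k * (c1 * Y1 t ^ 2 * X1 t + X1 t * (c1 * Y1 t ^ 2))
       + - c1 * (k * X1 t * Y1 t * Y1 t + Y1 t * (k * X1 t * Y1 t))) t);
    [rewrite HX0, HY0; ring | | intros; ring | exact Ht].
  intros r Hr.
  apply is_derive_within_plus; apply is_derive_within_scal; try exact Hr;
    apply is_derive_within_mult; auto. }
assert (HdZ : forall t, 0 <= t < S -> is_derive_within (fun t => 0 <= t < S)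
   (fun t => w' t + k * (w t * X1 t)) t (k * X1 t * (w' t + k * (w t * X1 t)))).
{ intros t Ht.
  refine (is_derive_within_eq _ _ _
    (q * w t + k * (w' t * X1 t + w t * (c1 * Y1 t ^ 2))) _ _ _).
  - apply is_derive_within_plus.
    + apply is_derive_is_derive_within; auto.
    + apply is_derive_within_scal; [exact Ht |].
      apply is_derive_within_mult; auto.
      apply is_derive_is_derive_within; auto.
  - rewrite <- (HE t Ht); ring. }
assert (HZ : forall s, 0 <= s < S -> w' s + k * (w s * X1 s) = 0).
{ intros s Hs.
  apply (linear_ode_zero S (fun t => w' t + k * (w t * X1 t)) (fun t => k * X1 t)
           s (k * X1 s)); auto.
  - rewrite w_0, w'_0, HX0; ring.
  - intros t Ht; apply Rmult_le_compat_l; [lra |].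
    apply (nonneg_derive_within_le S X1 (fun t => c1 * Y1 t ^ 2)); try lra; auto.
    intros r Hr; apply Rmult_le_pos; [lra | apply pow2_ge_0]. }
intros s Hs; split; [now apply HZ |].
rewrite (zero_derive_within_const S (fun t => w t * Y1 t)
  (fun t => w' t * Y1 t + w t * (k * X1 t * Y1 t)) s); auto.
- rewrite w_0, HY0; ring.
- intros t Ht; apply is_derive_within_mult; auto.
  apply is_derive_is_derive_within; auto.
- intros t Ht.
  transitivity ((w' t + k * (w t * X1 t)) * Y1 t); [ring |].
  rewrite HZ by exact Ht; ring.
Qed.

Lemma first_zero_blows_up (T : R) :
  0 < T -> w T = 0 -> (forall t, 0 <= t < T -> 0 < w t) ->
  comparison_blows_up c0 c1 X0 Y0.
Proof.
intros HT HwT Hpos.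
exists T, (fun t => - w' t / (k * w t)), (fun t => Y0 / w t).
split; [exact HT |].
split; [now apply explicit_comparison_solution |].
split.
- assert (Hc : continuous w T) by (apply (ex_derive_continuous (V := R_NormedModule)); eexists; apply hw).
  intros P [M HP].
  (* Where w < Y0 / (|M| + 1), the component Y0 / w alone exceeds M. *)
  assert (HM : 0 < Y0 / (Rabs M + 1))
    by (pose proof (Rabs_pos M); apply Rdiv_lt_0_compat; lra).
  assert (HwM : w T < Y0 / (Rabs M + 1)) by lra.
  pose proof (Hc _ (open_lt _ _ HwM)) as Hnear.
  change (locally T (fun t => w t < Y0 / (Rabs M + 1))) in Hnear.
  change (locally T (fun t => t < T -> P (norm (- w' t / (k * w t), Y0 / w t)))).
  generalize (filter_and _ _ Hnear (open_gt 0 T HT)).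
  apply filter_imp; intros t [Hwt Ht0] HtT.
  apply HP.
  pose proof (Hpos t ltac:(lra)) as Hw.
  apply Rlt_le_trans with (norm (Y0 / w t)).
  + change (M < Rabs (Y0 / w t)).
    apply Rle_lt_trans with (1 := Rle_abs M).
    apply Rlt_le_trans with (2 := Rle_abs _).
    apply (Rmult_lt_reg_r (w t)); [exact Hw |].
    replace (Y0 / w t * w t) with Y0 by (field; lra).
    pose proof (Rabs_pos M).
    assert (w t * (Rabs M + 1) < Y0); [| nra].
    replace Y0 with (Y0 / (Rabs M + 1) * (Rabs M + 1)) at 1 by (field; lra).
    apply Rmult_lt_compat_r; lra.
  + eapply Rle_trans; [apply Rmax_r | apply norm_prod].
- intros S X1 Y1 HS Hsol.
  pose proof (comparison_solution_linearised S X1 Y1 Hsol) as Hlin.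
  assert (HST : S <= T).
  { apply Rnot_lt_le; intros Hlt.
    destruct (Hlin T) as [_ H]; [lra |]; rewrite HwT in H; lra. }
  split; [exact HST |]; intros t Ht.
  destruct (Hlin t Ht) as [H1 H2].
  pose proof (Hpos t ltac:(lra)).
  split.
  + replace (w' t) with (- (k * (w t * X1 t))) by lra; field; lra.
  + rewrite <- H2; field; lra.
Qed.

End Comparison.

Lemma comparison_system_blows_up (c0 c1 X0 Y0 : R) :
  0 < c0 -> 0 < c1 -> 0 < X0 -> 0 < Y0 -> comparison_blows_up c0 c1 X0 Y0.
Proof.
intros Hc0 Hc1 HX HY.
set (k := c0 / 2).
assert (Hk : 0 < k) by (unfold k; lra).
destruct (linear_ode_reaches_zero (k * X0) (k * (k * X0 ^ 2 - c1 * Y0 ^ 2)))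
  as (w & w' & Hw & Hw' & H0 & H0' & t1 & Ht1 & Hwt1).
- now apply Rmult_lt_0_compat.
- assert (0 < k * (c1 * Y0 ^ 2))
    by (apply Rmult_lt_0_compat; [| apply Rmult_lt_0_compat; [| apply pow_lt]]; assumption).
  lra.
- destruct (first_zero w t1) as (T & HT & HwT & Hpos); auto.
  + intros t; apply (ex_derive_continuous (V := R_NormedModule)); eexists; apply Hw.
  + lra.
  + now apply (first_zero_blows_up c0 c1 X0 Y0 w w') with T.
Qed.

Theorem theorem9p1
  (J : R -> Prop) (sigma a b lam a' b' lam' : R -> R) (c0 c1 : R)
  (hJ : time_interval J)
  (hc0 : 0 < c0) (hc1 : 0 < c1)
  (hsigma : continuous_on J sigma)
  (ha : is_C1_on J a a') (hb : is_C1_on J b b') (hlam : is_C1_on J lam lam')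
  (hlam_pos : forall t, J t -> 0 < lam t)
  (hb_pos : forall t, J t -> 0 < b t)
  (hlam_eq : forall t, J t -> lam' t = - sigma t * lam t) :
  let A := fun t => lam t * a t in
  let B := fun t => sqrt (lam t) * b t in
  (forall t, J t -> sigma t >= c0 * A t) ->
  (forall t, J t -> a' t >= sigma t * a t + c1 * b t ^ 2) ->
  (forall t, J t -> b' t = sigma t * b t) ->
  (exists A' B' : R -> R, forall t, J t ->
     is_derive_within J A t (A' t) /\
     is_derive_within J B t (B' t) /\
     A' t >= c1 * B t ^ 2 /\
     B' t >= c0 / 2 * A t * B t) /\
  (0 < A 0 -> 0 < B 0 -> comparison_blows_up c0 c1 (A 0) (B 0)).
Proof.
intros A B Hs Ha Hb; split; [| now apply comparison_system_blows_up].
exists (fun t => lam' t * a t + lam t * a' t),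
       (fun t => lam' t * / (2 * sqrt (lam t)) * b t + sqrt (lam t) * b' t).
intros t Ht.
pose proof (hlam_pos t Ht) as Hl; pose proof (hb_pos t Ht) as Hbt.
pose proof (sqrt_lt_R0 _ Hl) as Hr.
pose proof (sqrt_sqrt (lam t) (Rlt_le _ _ Hl)) as Hrr.
split; [| split; [| split]].
- apply is_derive_within_mult; [exact Ht | now apply hlam | now apply ha].
- apply (is_derive_within_mult _ (fun t => sqrt (lam t))); [exact Ht | | now apply hb].
  apply (is_derive_within_comp _ lam sqrt); [exact Ht | now apply hlam |].
  auto_derive; [exact Hl | field; lra].
- rewrite hlam_eq by exact Ht; unfold B.
  replace (c1 * (sqrt (lam t) * b t) ^ 2)
    with (c1 * (sqrt (lam t) * sqrt (lam t)) * b t ^ 2) by ring.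
  rewrite Hrr.
  pose proof (Rmult_le_compat_l _ _ _ (Rlt_le _ _ Hl) (Rge_le _ _ (Ha t Ht))); lra.
- rewrite hlam_eq, Hb by exact Ht.
  assert (Hhalf : - sigma t * lam t * / (2 * sqrt (lam t)) * b t
            + sqrt (lam t) * (sigma t * b t) = / 2 * sigma t * B t).
  { unfold B; rewrite <- Hrr at 1; field; lra. }
  rewrite Hhalf.
  assert (HB : 0 < B t) by now apply Rmult_lt_0_compat.
  pose proof (Rmult_le_compat_r _ _ _ (Rlt_le _ _ HB) (Rge_le _ _ (Hs t Ht))); lra.
Qed.
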